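(* Let $N,d\ge 1$ be integers, let $m_1,\dots,m_N>0$ be masses, and let $i,j,k,l$ be distinct integers satisfying $1\le i,j,k,l\le N$. Suppose $m_i=m_j=m_k=m_l>0$. Let $\Delta_{ab}=\{(q_1,\dots,q_N)\in(\mathbb{R}^d)^N : q_a=q_b\}$ for $a\ne b$. Principal angles are taken in $(\mathbb{R}^d)^N\cong\mathbb{R}^N\otimes\mathbb{R}^d$ with respect to the inner product $\langle v,w\rangle=\sum_{a=1}^N m_a\, v_a\cdot w_a$, and are listed in nondecreasing order (there are $d(N-1)$ of them for each pair of subspaces below). (a) The first $d(N-2)$ principal angles between $\Delta_{ij}$ and $\Delta_{kl}$ are $0$, and the remaining $d$ principal angles are $\pi/2$. (b) The first $d(N-2)$ principal angles between $\Delta_{ij}$ and $\Delta_{jk}$ are $0$, and the remaining $d$ principal angles are $\pi/3$.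
   Context: The configuration space of $N$ point masses in $\mathbb{R}^d$ is $E=(\mathbb{R}^d)^N\cong\mathbb{R}^N\otimes\mathbb{R}^d$. It carries the inner product that is the tensor product of the mass metric $\langle \mathbf v,\mathbf w\rangle_M=\sum_{a=1}^N m_a v_a w_a$ on $\mathbb{R}^N$ and the standard Euclidean inner product on $\mathbb{R}^d$; that is, $\langle v,w\rangle=\sum_a m_a\, v_a\cdot w_a$ for $v,w\in(\mathbb{R}^d)^N$. The subspaces $\Delta_{ab}$ are called binary collision subspaces; each has codimension $d$. Principal angles: let $F,G$ be subspaces of a finite-dimensional real inner product space, and let $r=\min\{\dim F,\dim G\}$. The principal angles $\angle(F,G)=[\theta_1,\dots,\theta_r]$, with $0\le\theta_1\le\dots\le\theta_r\le\pi/2$, are defined recursively by $\cos\theta_k=\max\langle u,v\rangle=\langle u_k,v_k\rangle$. The maximum is over unit vectors $u\in F$, $v\in G$ with $\langle u,u_s\rangle=0$ and $\langle v,v_s\rangle=0$ for all $1\le s\le k-1$, and $u_k,v_k$ are vectors attaining it. *)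

(* Defs.v *)
From HB Require Import structures.
From mathcomp Require Import all_boot all_order all_algebra.
From mathcomp Require Import all_classical all_reals all_analysis.

Set Implicit Arguments.
Unset Strict Implicit.
Unset Printing Implicit Defensive.

Import Order.TTheory GRing.Theory Num.Theory.
Local Open Scope ring_scope.

Section PrincipalAngles.
Variables (R : realType) (V : vectType R) (dot : V -> V -> R).

(* The k-th maximization problem ranges over the pairs (x, y) below; indices
   start at 0, and u s, v s (s < k) are the principal vectors already chosen. *)
Definition admissible_pair (F G : {vspace V}) (u v : nat -> V) (k : nat)
    (x y : V) : Prop :=
  [/\ x \in F, y \in G, dot x x = 1, dot y y = 1
    & forall s, (s < k)%N -> dot x (u s) = 0 /\ dot y (v s) = 0].

(* A relation rather than a function, since the recursion depends on the
   choice of maximizers; only the values of u and v below size theta matter. *)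
Definition is_principal_angles (F G : {vspace V}) (theta : seq R) : Prop :=
  [/\ size theta = minn (\dim F) (\dim G),
      sorted <=%R theta,
      (forall t, t \in theta -> 0 <= t <= pi / 2)
    & exists u v : nat -> V, forall k, (k < size theta)%N ->
        [/\ admissible_pair F G u v k (u k) (v k),
            cos theta`_k = dot (u k) (v k)
          & forall x y, admissible_pair F G u v k x y ->
              dot x y <= dot (u k) (v k)]].

End PrincipalAngles.

Section Configurations.
Variables (R : realType) (N d : nat).

(* A configuration is an N x d matrix whose row a is the position of mass a. *)
Definition mass_dot (m : 'I_N -> R) (v w : 'M[R]_(N, d)) : R :=
  \sum_(a < N) m a * \sum_(c < d) v a c * w a c.

Definition row_diff (a b : 'I_N) (q : 'M[R]_(N, d)) : 'rV[R]_d :=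
  row a q - row b q.

Fact row_diff_is_linear a b : linear (row_diff a b).
Proof.
by move=> c p q; apply/rowP=> x; rewrite !mxE opprD addrACA mulrBr.
Qed.

HB.instance Definition _ a b :=
  GRing.isLinear.Build R 'M[R]_(N, d) 'rV[R]_d _ (row_diff a b)
    (row_diff_is_linear a b).

Definition collision (a b : 'I_N) : {vspace 'M[R]_(N, d)} :=
  lker (linfun (row_diff a b)).

Lemma mem_collision a b q : (q \in collision a b) = (row a q == row b q).
Proof. by rewrite memv_ker lfunE /= /row_diff subr_eq0. Qed.

End Configurations.

Arguments collision R {N} d a b.

(* Main.v *)
Require Import Defs.
From HB Require Import structures.
From mathcomp Require Import all_boot all_order all_algebra.
From mathcomp Require Import all_classical all_reals all_analysis.
From mathcomp Require Import ring lra zify.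

Set Implicit Arguments.
Unset Strict Implicit.
Unset Printing Implicit Defensive.

Import Order.TTheory GRing.Theory Num.Theory.
Local Open Scope ring_scope.

(* With W = F :&: G, write F = W + limg al and G = W + limg be orthogonally,
   where al and be have the same Gram form and the orthogonal projection of
   al a on limg be is cos t * be a (an isoclinic pair).  Every choice of
   principal vectors first exhausts an orthonormal basis of W with u k = v k;
   afterwards u k and v k lie in limg al and limg be, where Cauchy-Schwarz bounds
   the inner product by cos t, and equality forces v k = be a for u k = al a when
   cos t != 0, so that the next pair is again unconstrained.  For collision
   subspaces, al and be tensor a vector of R^N with R^d: e_k - e_l and e_i - e_j
   in (a), e_i + e_j - 2 e_k and 2 e_i - e_j - e_k in (b). *)

(** * Inner products on a vector space: unit vectors and orthonormal families *)

Section InnerProduct.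
Variables (R : realType) (V : vectType R) (dot : V -> V -> R).
Hypothesis dotC : forall x y, dot x y = dot y x.
Hypothesis dot_linearl : forall z, linear_for *%R (dot^~ z).
Hypothesis dot_gt0 : forall x, x != 0 -> 0 < dot x x.

Lemma dotDl x y z : dot (x + y) z = dot x z + dot y z.
Proof. by have := dot_linearl z 1 x y; rewrite scale1r mul1r. Qed.

Lemma dot0l z : dot 0 z = 0.
Proof. by have := dotDl 0 0 z; rewrite addr0; lra. Qed.

Lemma dotZl a x z : dot (a *: x) z = a * dot x z.
Proof. by have := dot_linearl z a x 0; rewrite addr0 dot0l addr0. Qed.

Lemma dotBl x y z : dot (x - y) z = dot x z - dot y z.
Proof. by rewrite dotDl -scaleN1r dotZl mulN1r. Qed.

Lemma dotZr a x z : dot x (a *: z) = a * dot x z.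
Proof. by rewrite !(dotC x) dotZl. Qed.

Lemma dotBr x y z : dot x (y - z) = dot x y - dot x z.
Proof. by rewrite !(dotC x) dotBl. Qed.

Lemma dot_suml (I : finType) (F : I -> V) z :
  dot (\sum_i F i) z = \sum_i dot (F i) z.
Proof. exact: (big_morph _ (fun x y => dotDl x y z) (dot0l z)). Qed.

Lemma dot_le0_eq0 x : dot x x <= 0 -> x = 0.
Proof. by move=> x0; apply/eqP; apply: contraTT x0 => /dot_gt0; rewrite -ltNge. Qed.

Lemma dot_ge0 x : 0 <= dot x x.
Proof. by have [->|/dot_gt0/ltW//] := eqVneq x 0; rewrite dot0l. Qed.

Lemma dot_unit_le1 x y : dot x x = 1 -> dot y y = 1 -> dot x y <= 1.
Proof.
move=> x1 y1; have := dot_ge0 (x - y).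
by rewrite dotBl !dotBr x1 y1 (dotC y x); lra.
Qed.

(** Equality case of Cauchy-Schwarz: the squared norm of [x - y] is 2 - 2 [dot x y], hence
    nonpositive. This is what later turns maximality into equality of vectors. *)
Lemma dot_unit_ge1 x y : dot x x = 1 -> dot y y = 1 -> 1 <= dot x y -> x = y.
Proof.
move=> x1 y1 xy1; apply/eqP; rewrite -subr_eq0; apply/eqP/dot_le0_eq0.
by rewrite dotBl !dotBr x1 y1 (dotC y x); lra.
Qed.

(** The n linear forms [dot^~ (e s)] map [W] into a space of dimension n < [\dim W], so by
    rank-nullity they have a common nonzero zero in [W], which is then normalized. The vectors [e s]
    may be arbitrary, so the lemma applies to any principal vectors already chosen. *)
Lemma unit_orthogonal_vector (W : {vspace V}) (e : nat -> V) n :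
  (n < \dim W)%N ->
  exists x, [/\ x \in W, dot x x = 1 & forall s, (s < n)%N -> dot x (e s) = 0].
Proof.
move=> nW; pose g (x : V) : 'rV[R]_n := \row_s dot x (e s).
have g_lin : linear g.
  by move=> a x y; apply/rowP=> s; rewrite !mxE dotDl dotZl.
pose L : {linear V -> 'rV[R]_n} :=
  HB.pack g (GRing.isLinear.Build _ _ _ _ g g_lin).
pose f := linfun L.
have fW : (\dim (f @: W) <= n)%N.
  by apply: leq_trans (dimvS (subvf _)) _; rewrite dimvf dim_matrix mul1r.
have := limg_ker_dim f W; set K := (W :&: lker f)%VS => KW.
have K0 : K != 0%VS.
  rewrite -dimv_eq0 -lt0n.
  move: nW; rewrite -KW => /leq_trans/(_ (leq_add (leqnn _) fW)).
  by rewrite -addn1 addnC leq_add2r.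
have := memv_pick K; rewrite memv_cap => /andP[xW /[!memv_ker] /eqP fx].
set x := vpick K in xW fx.
have x0 : x != 0 by rewrite vpick0.
have xx := dot_gt0 x0.
exists ((Num.sqrt (dot x x))^-1 *: x); split; first exact: memvZ.
  rewrite dotZl dotZr mulrA -expr2 exprVn sqr_sqrtr ?ltW//.
  by rewrite mulVf// gt_eqF.
move=> s sn; rewrite dotZl.
have := congr1 (fun r : 'rV_n => r 0 (Ordinal sn)) fx.
by rewrite lfunE /= !mxE => ->; rewrite mulr0.
Qed.

(** Orthogonality is only to earlier indices, and [e] is a total sequence, to match the shape of the
    recursion in [admissible_pair]. *)
Definition orthonormal_upto n (e : nat -> V) := forall k, (k < n)%N ->
  dot (e k) (e k) = 1 /\ forall s, (s < k)%N -> dot (e k) (e s) = 0.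

Lemma orthonormal_exists (W : {vspace V}) : exists e,
  orthonormal_upto (\dim W) e /\ forall k, (k < \dim W)%N -> e k \in W.
Proof.
suff H n : (n <= \dim W)%N -> exists e,
    orthonormal_upto n e /\ forall k, (k < n)%N -> e k \in W by exact: H.
elim: n => [|n IHn] nW; first by exists (fun=> 0); split.
have [e [e1 eW]] := IHn (ltnW nW).
have [x [xW x1 xe]] := unit_orthogonal_vector e nW.
exists (fun k => if k == n then x else e k); split=> k; rewrite ltnS leq_eqVlt.
  have [->/= _|kn /= kn'] := eqVneq k n.
    by split=> // s sn; rewrite ltn_eqF// xe.
  have [? H] := e1 k kn'; split=> // s sk.
  by rewrite ltn_eqF ?(ltn_trans sk)// H.
by have [//|kn /= /eW] := eqVneq k n.
Qed.

Lemma orthonormal_dot n e (s k : 'I_n) : orthonormal_upto n e ->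
  dot (e s) (e k) = (s == k)%:R.
Proof.
move=> e1; have [->|] := eqVneq s k; first exact: (e1 _ (ltn_ord k)).1.
rewrite -val_eqE /= neq_ltn => /orP[] lt; last exact: (e1 _ (ltn_ord s)).2.
by rewrite dotC; exact: (e1 _ (ltn_ord k)).2.
Qed.

(** Orthonormal vectors are free, and [\dim W] of them inside [W] form a basis, so orthogonality to
    each of them passes to all of [W]. *)
Lemma orthogonal_to_span (W : {vspace V}) e x : orthonormal_upto (\dim W) e ->
  (forall k, (k < \dim W)%N -> e k \in W) ->
  (forall k, (k < \dim W)%N -> dot x (e k) = 0) ->
  forall w, w \in W -> dot x w = 0.
Proof.
move=> e1 eW xe w wW.
pose X := [tuple e k | k < \dim W].
have XE (k : 'I_(\dim W)) : X`_k = e k.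
  by rewrite -tnth_nth tnth_mktuple.
have fX : free X.
  apply/freeP => c c0 k.
  have := congr1 (dot^~ (e k)) c0; rewrite dot0l dot_suml (bigD1 k)//= big1.
    by rewrite XE dotZl (orthonormal_dot _ _ e1) eqxx mulr1 addr0.
  by move=> s sk; rewrite XE dotZl (orthonormal_dot _ _ e1) (negbTE sk) mulr0.
have bX : basis_of W X.
  rewrite basisEfree fX size_tuple leqnn andbT /=.
  by apply/span_subvP => _ /mapP[k _ ->]; exact: eW.
rewrite (coord_basis bX wW) dotC dot_suml big1// => k _.
by rewrite XE dotZl dotC xe// mulr0.
Qed.


(** * Principal angles of two subspaces that differ by an isoclinic pair *)

Section IsoclinicSum.
Variables (U : vectType R) (al be : 'Hom(U, V)) (W : {vspace V}) (t : R).
Hypothesis t_gt0 : 0 < t.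
Hypothesis t_le : t <= pi / 2.
Hypothesis al_inj : forall a, al a = 0 -> a = 0.
Hypothesis albe_isometry : forall a b, dot (al a) (al b) = dot (be a) (be b).
Hypothesis albe_cos : forall a b, dot (al a) (be b) = cos t * dot (be a) (be b).
Hypothesis W_al : forall w a, w \in W -> dot w (al a) = 0.
Hypothesis W_be : forall w a, w \in W -> dot w (be a) = 0.

Local Notation F := (W + limg al)%VS.
Local Notation G := (W + limg be)%VS.

Lemma cost_ge0 : 0 <= cos t.
Proof.
apply: cos_ge0_pihalf; rewrite t_le andbT.
by have := pi_gt0 R; move: t_gt0 t_le; lra.
Qed.

Lemma cost_lt1 : cos t < 1.
Proof.
rewrite -cos0 ltr_cos ?in_itv/= ?lexx ?pi_ge0 ?ltW//.
by have := pi_gt0 R; move: t_gt0 t_le; lra.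
Qed.

Lemma be_inj a : be a = 0 -> a = 0.
Proof.
move=> a0; apply/al_inj/dot_le0_eq0.
by rewrite albe_isometry a0 dot0l.
Qed.

Lemma dim_limg_inj (f : 'Hom(U, V)) : (forall a, f a = 0 -> a = 0) ->
  \dim (limg f) = dim U.
Proof.
move=> f0; rewrite limg_dim_eq ?dimvf//; apply/eqP; rewrite -subv0.
apply/subvP => a; rewrite memv_cap memv_ker => /andP[_ /eqP /f0 ->].
exact: mem0v.
Qed.

Lemma dim_orthogonal_sum (f : 'Hom(U, V)) : (forall a, f a = 0 -> a = 0) ->
  (forall w a, w \in W -> dot w (f a) = 0) ->
  \dim (W + limg f) = (\dim W + dim U)%N.
Proof.
move=> f0 Wf; rewrite dimv_disjoint_sum ?dim_limg_inj//.
apply/eqP; rewrite -subv0; apply/subvP => x; rewrite memv_cap => /andP[xW].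
move=> /memv_imgP[a _ xa]; rewrite memv0; apply/eqP/dot_le0_eq0.
by rewrite {2}xa Wf.
Qed.

(** The component w of [x] in [W] satisfies [dot w w = dot x w = 0], so only the component in
    [limg f] survives. *)
Lemma orthogonal_part (f : 'Hom(U, V)) x :
  (forall w a, w \in W -> dot w (f a) = 0) ->
  x \in (W + limg f)%VS -> (forall w, w \in W -> dot x w = 0) ->
  exists a, x = f a.
Proof.
move=> Wf /memv_addP[w wW [_ /memv_imgP[a _ ->] ->]] H; exists a.
have := H w wW; rewrite dotDl (dotC (f a)) Wf// addr0 => w0.
by rewrite (dot_le0_eq0 (x := w)) ?add0r// w0.
Qed.

(** If w + al a = w' + be b, then al a - be b lies in [W] and is orthogonal to [W], so al a = be b.
    The cosine relation then bounds the squared norm of be a by cos t times itself, and cos t < 1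
    forces a = 0. *)
Lemma mem_cap_isoclinic x : x \in F -> x \in G -> x \in W.
Proof.
move=> /memv_addP[w wW [_ /memv_imgP[a _ ->] ->]].
move=> /memv_addP[w' wW' [_ /memv_imgP[b _ ->] E]].
have Eab : al a - be b = w' - w.
  by apply/eqP; rewrite subr_eq addrAC -E addrAC subrr add0r.
have ab : al a = be b.
  apply/eqP; rewrite -subr_eq0; apply/eqP/dot_le0_eq0.
  by rewrite {1}Eab dotBr W_al ?W_be ?memvB ?subrr.
have baa := albe_cos a b; rewrite -{1}ab albe_isometry in baa.
have bbb : dot (be b) (be b) = dot (be a) (be a) by rewrite -ab albe_isometry.
have : dot (be a) (be a) <= cos t * dot (be a) (be a).
  rewrite {1}baa ler_wpM2l ?cost_ge0//.
  have := dot_ge0 (be a - be b); rewrite dotBl !dotBr bbb (dotC (be b)).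
  lra.
have := cost_lt1; have := dot_ge0 (be a) => n0 c1 n1.
have : be a = 0 by apply: dot_le0_eq0; nra.
by move/be_inj->; rewrite linear0 addr0.
Qed.

Lemma dot_al_be_le a b : dot (al a) (al a) = 1 -> dot (be b) (be b) = 1 ->
  dot (al a) (be b) <= cos t.
Proof.
rewrite albe_isometry => a1 b1; rewrite albe_cos.
have := dot_unit_le1 a1 b1; have := cost_ge0; nra.
Qed.

(** The first [\dim W] vectors of [u], which are also those of [v], form an orthonormal basis of
    [W]. Both members of a later pair are therefore orthogonal to [W], and [orthogonal_part]
    applies. *)
Lemma admissible_pair_tail u v k x y : (\dim W <= k)%N ->
  orthonormal_upto (\dim W) u ->
  (forall s, (s < \dim W)%N -> u s = v s /\ u s \in W) ->
  admissible_pair dot F G u v k x y ->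
  exists a b,
    [/\ x = al a, y = be b, dot (al a) (al a) = 1 & dot (be b) (be b) = 1].
Proof.
move=> pk u1 uW [xF yG x1 y1 xy].
have [a xa] : exists a, x = al a.
  apply: orthogonal_part => //; apply: orthogonal_to_span u1 _ _ => s sp.
    exact: (uW s sp).2.
  by have [] := xy s (leq_trans sp pk).
have [b yb] : exists b, y = be b.
  apply: orthogonal_part => //; apply: orthogonal_to_span u1 _ _ => s sp.
    exact: (uW s sp).2.
  by rewrite (uW s sp).1; have [] := xy s (leq_trans sp pk).
by exists a, b; rewrite -xa -yb.
Qed.

(** Shows that the value 1 is attainable as long as the earlier pairs coincide and [W] is not
    exhausted. *)
Lemma admissible_pair_common u v k : (k < \dim W)%N ->
  (forall s, (s < k)%N -> u s = v s) ->
  exists w, admissible_pair dot F G u v k w w.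
Proof.
move=> kp uv; have [w [wW w1 wu]] := unit_orthogonal_vector u kp.
exists w; split => // [||s sk].
- by rewrite (subvP (addvSl _ _)).
- by rewrite (subvP (addvSl _ _)).
- by rewrite -(uv _ sk) wu.
Qed.

(** Supplies a competitor of value cos t once [W] is exhausted. When the earlier pairs are matched,
    the isometry carries orthogonality to the [u s] over to orthogonality to the [v s]. *)
Lemma admissible_pair_isoclinic u v k : (\dim W <= k < \dim W + dim U)%N ->
  (forall s, (s < \dim W)%N -> u s \in W /\ v s \in W) ->
  (forall s, (\dim W <= s < k)%N -> exists a, u s = al a /\ v s = be a) ->
  exists2 a, admissible_pair dot F G u v k (al a) (be a)
    & dot (be a) (be a) = 1.
Proof.
move=> /andP[pk kpq] uvW uv.
have : (k - \dim W < \dim (limg al))%N by rewrite dim_limg_inj// ltn_subLR.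
(* The shift by [\dim W] keeps only the k - [\dim W] constraints coming from [limg al]; those coming
   from [W] hold automatically. *)
move=> /(unit_orthogonal_vector (fun s => u (s + \dim W)%N)).
move=> [_ [/memv_imgP[a _ ->] a1 au]]; exists a; last by rewrite -albe_isometry.
split=> [||//||s sk].
- by rewrite (subvP (addvSr _ _))// memv_img ?memvf.
- by rewrite (subvP (addvSr _ _))// memv_img ?memvf.
- by rewrite -albe_isometry.
have [sp|ps] := ltnP s (\dim W).
  by have [? ?] := uvW s sp; rewrite (dotC _ (u s)) (dotC _ (v s)) W_al ?W_be.
have [|b [ub vb]] := uv s; first by rewrite ps.
have := au (s - \dim W)%N; rewrite subnK// ltn_sub2r ?(leq_ltn_trans ps)//.
by move=> /(_ isT); rewrite ub vb -albe_isometry.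
Qed.

(** The principal vectors are not unique, so the values must be computed for every possible choice
    of maximizers. *)
Lemma principal_values u v :
  (forall k, (k < \dim W + dim U)%N ->
    admissible_pair dot F G u v k (u k) (v k) /\
    forall x y, admissible_pair dot F G u v k x y ->
      dot x y <= dot (u k) (v k)) ->
  forall k, (k < \dim W + dim U)%N ->
    dot (u k) (v k) = if (k < \dim W)%N then 1 else cos t.
Proof.
move=> uv.
(* A common unit vector competes with value 1, so the maximizers satisfy [1 <= dot (u k) (v k)];
   hence they coincide and lie in both subspaces, that is, in [W]. *)
have head k : (k < \dim W)%N -> u k = v k /\ u k \in W.
  elim/ltn_ind: k => k IH kp.
  have [[uF vG u1 v1 _] max] := uv k (ltn_addr _ kp).
  have [|w wk] := @admissible_pair_common u v k kp.
    by move=> s sk; have [] := IH s sk (ltn_trans sk kp).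
  have uvk : u k = v k.
    apply: dot_unit_ge1 => //; apply: le_trans (max _ _ wk).
    by have [_ _ ->] := wk.
  by split=> //; apply: mem_cap_isoclinic => //; rewrite uvk.
have u1 : orthonormal_upto (\dim W) u.
  move=> k kp; have [[_ _ uk _ H] _] := uv k (ltn_addr _ kp).
  by split=> // s /H[].
move=> k kpq; case: ltnP => [kp|pk].
  have [[_ _ uk _ _] _] := uv k kpq.
  by have [<- _] := head k kp.
have tail k' : (\dim W <= k' < \dim W + dim U)%N -> exists a b,
    [/\ u k' = al a, v k' = be b, dot (be a) (be a) = 1 & dot (be b) (be b) = 1].
  move=> /andP[pk' kpq']; have [adm _] := uv k' kpq'.
  have [a [b [ua vb a1 b1]]] := admissible_pair_tail pk' u1 head adm.
  by exists a, b; rewrite -albe_isometry.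
(* For cos t = 0 maximality no longer ties [v k] to [u k], but every pair in the tail has inner
   product 0 anyway. *)
have [c0|c0] := eqVneq (cos t) 0.
  have [|a [b [-> -> _ _]]] := tail k; first by rewrite pk.
  by rewrite albe_cos c0 mul0r.
have c_gt0 : 0 < cos t by rewrite lt_neqAle eq_sym c0 cost_ge0.
(* By induction the earlier pairs are matched, so a competitor of value cos t exists. Maximality
   gives cos t <= cos t [dot (be a) (be b)]; dividing by cos t > 0 yields be a = be b. *)
have step k' : (\dim W <= k' < \dim W + dim U)%N ->
    exists a, [/\ u k' = al a, v k' = be a & dot (be a) (be a) = 1].
  elim/ltn_ind: k' => k' IH pkq; have [a [b [ua vb a1 b1]]] := tail k' pkq.
  have [||a' adm a'1] := @admissible_pair_isoclinic u v k' pkq.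
  - by move=> s sp; have [<-] := head s sp.
  - move=> s /andP[ps sk]; have [|c [uc vc _]] := IH s sk; last by exists c.
    by rewrite ps (ltn_trans sk)//; case/andP: pkq.
  have [_ kpq'] := andP pkq.
  have := (uv k' kpq').2 _ _ adm.
  rewrite ua vb !albe_cos a'1 ler_pM2l// => /(dot_unit_ge1 a1 b1) ab.
  by exists a; rewrite ab.
have [|a [-> -> a1]] := step k; first by rewrite pk.
by rewrite albe_cos a1 mulr1.
Qed.

Lemma principal_vectors_exist : exists u v,
  forall k, (k < \dim W + dim U)%N ->
    [/\ admissible_pair dot F G u v k (u k) (v k),
        dot (u k) (v k) = (if (k < \dim W)%N then 1 else cos t)
      & forall x y, admissible_pair dot F G u v k x y ->
          dot x y <= dot (u k) (v k)].
Proof.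
have [e [e1 eW]] := orthonormal_exists W.
have [f []] := orthonormal_exists (limg al).
rewrite dim_limg_inj// => f1 fA.
(* Preimages under [al] of an orthonormal basis of [limg al]. Their images under [be] are
   orthonormal too, by the isometry, and serve as the matching [v k]. *)
pose g k := (al^-1)%VF (f (k - \dim W)%N).
have alg k : (\dim W <= k < \dim W + dim U)%N -> al (g k) = f (k - \dim W)%N.
  by move=> /andP[pk kpq]; rewrite limg_lfunVK// fA// ltn_subLR.
pose u k := if (k < \dim W)%N then e k else al (g k).
pose v k := if (k < \dim W)%N then e k else be (g k).
have uE k : (k < \dim W)%N -> u k = v k /\ u k \in W.
  by move=> kp; rewrite /u /v kp eW.
have u1 : orthonormal_upto (\dim W) u.
  move=> k kp; rewrite /u kp; have [? H] := e1 k kp.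
  by split=> // s sk; rewrite (ltn_trans sk)// H.
exists u, v => k kpq; have [kp|pk] := ltnP k (\dim W).
  rewrite /u /v kp; split.
  - split; try exact: (e1 k kp).1.
    + by rewrite (subvP (addvSl _ _))// eW.
    + by rewrite (subvP (addvSl _ _))// eW.
    + by move=> s sk; rewrite (ltn_trans sk)//; have [_ ->] := e1 k kp.
  - exact: (e1 k kp).1.
  - by move=> x y [_ _ x1 y1 _]; rewrite (e1 k kp).1 dot_unit_le1.
have kq : (k - \dim W < dim U)%N by rewrite ltn_subLR.
have gk1 : dot (al (g k)) (al (g k)) = 1.
  by rewrite alg ?pk//; exact: (f1 _ kq).1.
have uvk : dot (u k) (v k) = cos t.
  by rewrite /u /v ltnNge pk /= albe_cos -albe_isometry gk1 mulr1.
split=> //.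
  split.
  - by rewrite /u ltnNge pk /= (subvP (addvSr _ _))// memv_img ?memvf.
  - by rewrite /v ltnNge pk /= (subvP (addvSr _ _))// memv_img ?memvf.
  - by rewrite /u ltnNge pk.
  - by rewrite /v ltnNge pk /= -albe_isometry.
  move=> s sk; rewrite /u /v [(k < _)%N]ltnNge pk /=.
  case: ltnP => [sp|ps]; first by rewrite !(dotC _ (e s)) W_al ?W_be ?eW.
  rewrite -albe_isometry !alg ?pk ?ps ?(ltn_trans sk)//.
  by split; apply: (f1 _ kq).2; rewrite ltn_sub2r ?(leq_ltn_trans ps).
move=> x y /(admissible_pair_tail pk u1 uE)[a [b [-> -> a1 b1]]].
by rewrite uvk dot_al_be_le.
Qed.

(** From left to right, [principal_values] fixes the cosines, and injectivity of the cosine on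
    [0, pi] recovers the angles. The converse needs only the single choice given by
    [principal_vectors_exist]. *)
Lemma is_principal_angles_isoclinic theta :
  is_principal_angles dot F G theta <->
  theta = nseq (\dim W) 0 ++ nseq (dim U) t.
Proof.
have nthE k : (k < \dim W + dim U)%N ->
    (nseq (\dim W) 0 ++ nseq (dim U) t)`_k = if (k < \dim W)%N then 0 else t.
  move=> kpq; rewrite nth_cat size_nseq !nth_nseq; case: ltnP => // pk.
  by rewrite ltn_subLR// kpq.
have cosE k : cos (if (k < \dim W)%N then 0 else t) =
    if (k < \dim W)%N then 1 else cos t by case: ifP; rewrite ?cos0.
have sz : minn (\dim F) (\dim G) = (\dim W + dim U)%N.
  by rewrite !dim_orthogonal_sum ?minnn//; exact: be_inj.
split=> [[]|->].
  rewrite sz => szth _ bnd [u [v uv]].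
  rewrite szth in uv.
  have val := @principal_values u v
    (fun k kpq => let: And3 a _ c := uv k kpq in conj a c).
  apply: (@eq_from_nth _ 0) => [|k]; first by rewrite szth size_cat !size_nseq.
  rewrite szth => kpq; rewrite nthE//.
  have /bnd /andP[th0 thpi] : theta`_k \in theta by rewrite mem_nth ?szth.
  have := pi_gt0 R; move: t_gt0 t_le => t0 t2 pi0.
  apply: (@cos_inj R); rewrite ?in_itv/=.
  - by rewrite th0/=; lra.
  - by case: ifP => _; rewrite ?lexx ?ltW//=; lra.
  - by have [_ -> _] := uv k kpq; rewrite val// cosE.
split.
- by rewrite sz size_cat !size_nseq.
- apply/(sortedP 0) => k; rewrite size_cat !size_nseq => kpq.
  rewrite !nthE// ?(ltnW kpq)//; case: ltnP => // pk.
  + by case: ifP => // _; exact: ltW.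
  + by rewrite ltnNge (leq_trans pk).
- have := pi_gt0 R; move: t_gt0 t_le => t0 t2 pi0.
  move=> x; rewrite mem_cat !mem_nseq.
  by move=> /orP[] /andP[_ /eqP->]; apply/andP; split; lra.
have [u [v uv]] := principal_vectors_exist.
exists u, v => k; rewrite size_cat !size_nseq => kpq; rewrite nthE// cosE.
by have [? <- ?] := uv k kpq; split.
Qed.

End IsoclinicSum.
End InnerProduct.

(** * The mass metric, pure tensors and collision subspaces *)

Section MassMetric.
Variables (R : realType) (N d : nat) (m : 'I_N -> R).
Hypothesis m_gt0 : forall a, 0 < m a.
Implicit Types (s r : 'cV[R]_N) (v w : 'M[R]_(N, d)).

Lemma mass_dotC v w : mass_dot m v w = mass_dot m w v.
Proof.
by apply: eq_bigr => a _; congr (_ * _); apply: eq_bigr => c _; rewrite mulrC.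
Qed.

Lemma mass_dot_linearl w : linear_for *%R ((mass_dot m)^~ w).
Proof.
move=> x u v; rewrite /mass_dot mulr_sumr -big_split; apply: eq_bigr => a _ /=.
rewrite mulrCA -mulrDr; congr (_ * _); rewrite mulr_sumr -big_split.
by apply: eq_bigr => c _ /=; rewrite !mxE mulrDl mulrA.
Qed.

Lemma mass_dot_gt0 v : v != 0 -> 0 < mass_dot m v v.
Proof.
have row_ge0 a : 0 <= m a * \sum_(c < d) v a c * v a c.
  apply: mulr_ge0; first exact: ltW.
  by apply: sumr_ge0 => c _; rewrite -expr2 sqr_ge0.
move=> /matrix0Pn[a [c vac]]; rewrite /mass_dot (bigD1 a)//=.
rewrite ltr_wpDr ?sumr_ge0// mulr_gt0// (bigD1 c)//=.
rewrite ltr_wpDr ?sumr_ge0//; first by move=> x _; rewrite -expr2 sqr_ge0.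
by rewrite -expr2 exprn_even_gt0.
Qed.

(** The column-by-row product [s *m a] is the pure tensor of s and a. Pairing with it reduces to
    mass-weighted sums over R^N, one for each column of [w]. *)
Lemma mass_dot_mulmx s (a : 'rV[R]_d) w :
  mass_dot m w (s *m a) = \sum_c (\sum_b m b * s b 0 * w b c) * a 0 c.
Proof.
under [RHS]eq_bigr do rewrite mulr_suml.
rewrite exchange_big; apply: eq_bigr => b _; rewrite mulr_sumr.
by apply: eq_bigr => c _; rewrite !mxE big_ord1; ring.
Qed.

Lemma mass_dot_mulmx2 s r (a b : 'rV[R]_d) : mass_dot m (s *m a) (r *m b) =
  (\sum_x m x * s x 0 * r x 0) * \sum_c a 0 c * b 0 c.
Proof.
rewrite mass_dot_mulmx mulr_sumr; apply: eq_bigr => c _.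
rewrite mulrA; congr (_ * _); rewrite mulr_suml.
by apply: eq_bigr => x _; rewrite !mxE big_ord1; ring.
Qed.

Lemma collisionP a b (q : 'M[R]_(N, d)) :
  reflect (forall c, q a c = q b c) (q \in collision R d a b).
Proof.
rewrite mem_collision; apply: (iffP eqP) => [H c|H].
  by have := congr1 (fun x : 'rV[R]_d => x 0 c) H; rewrite !mxE.
by apply/rowP => c; rewrite !mxE.
Qed.

Lemma dim_collision (a b : 'I_N) : a != b -> \dim (collision R d a b) = (d * N.-1)%N.
Proof.
move=> ab; pose f : 'Hom('M[R]_(N, d), 'rV[R]_d) := linfun (row_diff a b).
have := limg_ker_dim f fullv.
rewrite capfv -[lker f]/(collision R d a b).
suff -> : limg f = fullv.
  rewrite !dimvf (_ : dim 'M[R]_(N, d) = (N * d)%N)//.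
  rewrite (_ : dim 'rV[R]_d = d); last exact: mul1n.
  have := mulSnr N.-1 d; rewrite prednK ?(leq_ltn_trans (leq0n a))// => ->.
  by move/addIn; rewrite mulnC.
apply/eqP; rewrite eqEsubv subvf /=; apply/subvP => v _; apply/memv_imgP.
(* Surjectivity of [row_diff a b]: put [v] in row [a] and zero in every other row. *)
exists (delta_mx a 0 *m v); first exact: memvf.
rewrite lfunE; apply/rowP => c.
by rewrite !mxE !big_ord1 !mxE !eqxx/= eq_sym (negbTE ab) mul1r mul0r subr0.
Qed.

Lemma collision_sum s (a b a' b' : 'I_N) : s a 0 = s b 0 -> s a' 0 != s b' 0 ->
  (collision R d a b :&: collision R d a' b' +
    limg (linfun (mulmx s : 'rV[R]_d -> 'M[R]_(N, d))))%VS =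
  collision R d a b.
Proof.
move=> sab sab'; apply/eqP; rewrite eqEsubv subv_add capvSl /=; apply/andP; split.
  apply/subvP => _ /memv_imgP[v _ ->]; apply/collisionP => c.
  by rewrite lfunE !mxE !big_ord1 sab.
apply/subvP => q /collisionP qab.
(* The multiple of [s] is chosen so that subtracting it makes rows [a'] and [b'] equal; rows [a] and
   [b] stay equal because [s] agrees there. *)
pose v := (s a' 0 - s b' 0)^-1 *: row_diff a' b' q.
apply/memv_addP; exists (q - s *m v); last first.
  exists (s *m v); last by rewrite subrK.
  by apply/memv_imgP; exists v; rewrite ?memvf ?lfunE.
have vxE x c : (q - s *m v) x c =
    q x c - s x 0 * (s a' 0 - s b' 0)^-1 * (q a' c - q b' c).
  by rewrite !mxE big_ord1 !mxE mulrA.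
rewrite memv_cap; apply/andP; split; apply/collisionP => c; rewrite !vxE.
  by rewrite qab sab.
by field; rewrite subr_eq0.
Qed.

(** Reduces the geometry in the tensor product to scalar identities in R^N: [s] and [r] must have
    equal norm, make the angle t, and be orthogonal to every g compatible with both collisions. *)
Lemma collision_principal_angles s r (a b a' b' : 'I_N) t : a != b ->
  0 < t -> t <= pi / 2 ->
  s a 0 = s b 0 -> s a' 0 != s b' 0 ->
  r a' 0 = r b' 0 -> r a 0 != r b 0 ->
  \sum_x m x * s x 0 * s x 0 = \sum_x m x * r x 0 * r x 0 ->
  \sum_x m x * r x 0 * s x 0 = cos t * \sum_x m x * r x 0 * r x 0 ->
  (forall g, g a = g b -> g a' = g b' -> \sum_x m x * s x 0 * g x = 0) ->
  (forall g, g a = g b -> g a' = g b' -> \sum_x m x * r x 0 * g x = 0) ->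
  forall theta, is_principal_angles (mass_dot m)
      (collision R d a b) (collision R d a' b') theta <->
    theta = nseq (d * (N - 2)) 0 ++ nseq d t.
Proof.
move=> ab t_gt0 t_le sab sab' rab' rab ss_rr rs s_orth r_orth theta.
have mul_inj (q : 'cV[R]_N) x y : q x 0 != q y 0 ->
    forall v : 'rV[R]_d, linfun (mulmx q) v = 0 -> v = 0.
  move=> qxy v; rewrite lfunE => qv0; apply/rowP => c.
  have qv0E z : q z 0 * v 0 c = 0.
    by have := congr1 (fun A : 'M[R]_(N, d) => A z c) qv0; rewrite !mxE big_ord1.
  apply: (mulfI (x := q x 0 - q y 0)); first by rewrite subr_eq0.
  by rewrite mxE mulr0 mulrBl !qv0E subrr.
set W := (collision R d a b :&: collision R d a' b')%VS.
have W_orth (q : 'cV[R]_N) : (forall g, g a = g b -> g a' = g b' ->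
    \sum_x m x * q x 0 * g x = 0) ->
    forall w (c : 'rV[R]_d), w \in W -> mass_dot m w (linfun (mulmx q) c) = 0.
  move=> q_orth w v; rewrite memv_cap => /andP[/collisionP wab /collisionP wab'].
  by rewrite lfunE /= mass_dot_mulmx big1// => c _; rewrite q_orth ?mul0r.
have FE := collision_sum sab sab'.
have GE := collision_sum rab' rab; rewrite -/W in FE; rewrite capvC -/W in GE.
(* The dimension of the intersection is read off from the orthogonal decomposition of the first
   collision subspace, whose second summand has dimension d. *)
have dimW : (\dim W + d = d * N.-1)%N.
  rewrite -(dim_collision ab) -FE.
  rewrite (dim_orthogonal_sum mass_dot_gt0).
  - by rewrite (_ : dim 'rV[R]_d = d)//; exact: mul1n.
  - exact: mul_inj sab'.
  - exact: W_orth s_orth.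
have := @is_principal_angles_isoclinic R _ _ mass_dotC mass_dot_linearl
  mass_dot_gt0 _ (linfun (mulmx s) : 'Hom('rV[R]_d, _)) (linfun (mulmx r))
  W t t_gt0 t_le.
rewrite FE GE (_ : dim 'rV[R]_d = d); last exact: mul1n.
move=> ->.
- suff -> : \dim W = (d * (N - 2))%N by [].
  (* Since [a] and [b] are distinct indices, N >= 2, so the truncated subtraction satisfies (N - 2)
     + 1 = N - 1. *)
  apply: (@addIn d); rewrite dimW -mulnSr; congr muln.
  by move: ab (ltn_ord a) (ltn_ord b); rewrite -val_eqE /=; lia.
- exact: mul_inj sab'.
- by move=> u v; rewrite !lfunE /= !mass_dot_mulmx2 ss_rr.
- move=> u v; rewrite !lfunE /= !mass_dot_mulmx2 mulrA -rs; congr (_ * _).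
  by apply: eq_bigr => x _; rewrite mulrAC.
- exact: W_orth s_orth.
- exact: W_orth r_orth.
Qed.

Definition col3 (i j k : 'I_N) (x y z : R) : 'cV[R]_N :=
  x *: delta_mx i 0 + y *: delta_mx j 0 + z *: delta_mx k 0.

Lemma sum_col3 i j k x y z (g : 'I_N -> R) :
  \sum_b m b * col3 i j k x y z b 0 * g b =
  m i * x * g i + m j * y * g j + m k * z * g k.
Proof.
have sum_delta u (e : R) : \sum_b m b * (e * (b == u)%:R) * g b = m u * e * g u.
  rewrite (bigD1 u)//= eqxx mulr1 big1 ?addr0// => b /negbTE ->.
  by rewrite !mulr0 mul0r.
rewrite -!sum_delta -!big_split; apply: eq_bigr => b _ /=.
by rewrite !mxE !andbT; ring.
Qed.

End MassMetric.

(** * The cosine of pi/3 and the two pairs of collision subspaces *)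

Lemma cos_pi3 (R : realType) : cos (pi / 3) = 2^-1 :> R.
Proof.
set x : R := pi / 3; have pi0 := pi_gt0 R.
have c0 : 0 < cos x by apply: cos_gt0_pihalf; apply/andP; split; rewrite /x; lra.
(* As 3x = pi, the triple-angle formula makes c = cos x a root of 4c^3 - 3c + 1 = (c + 1)(2c - 1)^2,
   and c > 0 leaves only c = 1/2. *)
have : cos (x + (x + x)) = -1 by rewrite -cospi; congr cos; rewrite /x; field.
rewrite !cosD sinD => E; have E2 := cos2Dsin2 x.
have /eqP : (cos x + 1) * (2 * cos x - 1) ^+ 2 = 0.
  have s2 : sin x ^+ 2 = 1 - cos x ^+ 2 by rewrite -E2; ring.
  have -> : (cos x + 1) * (2 * cos x - 1) ^+ 2 =
    4 * cos x ^+ 3 - 3 * cos x + 1 by ring.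
  suff: cos x * (cos x * cos x - sin x ^+ 2) - 2 * cos x * sin x ^+ 2 = -1.
    by rewrite s2; lra.
  by rewrite -E; ring.
rewrite mulf_eq0 sqrf_eq0 => /orP[] /eqP; lra.
Qed.

Theorem corollary3p2 (R : realType) (N d : nat) (hN : (1 <= N)%N)
    (hd : (1 <= d)%N) (m : 'I_N -> R) (hm : forall a, 0 < m a)
    (i j k l : 'I_N) (hdistinct : uniq [:: i; j; k; l])
    (hij : m i = m j) (hjk : m j = m k) (hkl : m k = m l) :
  (forall theta : seq R,
     is_principal_angles (mass_dot m) (collision R d i j) (collision R d k l)
       theta <->
     theta = nseq (d * (N - 2)) 0 ++ nseq d (pi / 2)) /\
  (forall theta : seq R,
     is_principal_angles (mass_dot m) (collision R d i j) (collision R d j k)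
       theta <->
     theta = nseq (d * (N - 2)) 0 ++ nseq d (pi / 3)).
Proof.
have pi0 := pi_gt0 R.
move: hdistinct; rewrite /= !inE !negb_or andbT.
move=> /and3P[/and3P[ij ik il] /andP[jk jl] kl].
have eqs := (negbTE ij, negbTE ik, negbTE il, negbTE jk, negbTE jl, negbTE kl,
  eq_sym j i, eq_sym k i, eq_sym l i, eq_sym k j, eq_sym l j, eq_sym l k).
split.
  (* The first index of each [col3] is a filler with coefficient 0. The two vectors have disjoint
     supports, so their inner product is 0 = cos (pi / 2). *)
  apply: (@collision_principal_angles R N d m hm
    (col3 i k l 0 1 (-1)) (col3 k i j 0 1 (-1))) => //.
  - by lra.
  - by rewrite !mxE !eqxx !eqs /=; lra.
  - by rewrite !mxE !eqxx !eqs /=; apply/eqP; lra.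
  - by rewrite !mxE !eqxx !eqs /=; lra.
  - by rewrite !mxE !eqxx !eqs /=; apply/eqP; lra.
  - by rewrite !sum_col3 !mxE !eqxx !eqs /= hij hjk hkl; ring.
  - by rewrite !sum_col3 !mxE !eqxx !eqs /= cos_pihalf; ring.
  - by move=> g gij gkl; rewrite sum_col3 gkl hkl; ring.
  - by move=> g gij gkl; rewrite sum_col3 gij hij; ring.
(* With common mass m, both vectors have squared norm 6m and their inner product is (2 - 1 + 2)m =
   3m, so the cosine is 1/2; the signs are chosen to make the angle acute. *)
apply: (@collision_principal_angles R N d m hm
  (col3 i j k 1 1 (-2)) (col3 i j k 2 (-1) (-1))) => //.
- by lra.
- by lra.
- by rewrite !mxE !eqxx !eqs /=; lra.
- by rewrite !mxE !eqxx !eqs /=; apply/eqP; lra.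
- by rewrite !mxE !eqxx !eqs /=; lra.
- by rewrite !mxE !eqxx !eqs /=; apply/eqP; lra.
- by rewrite !sum_col3 !mxE !eqxx !eqs /= hij hjk; ring.
- by rewrite !sum_col3 !mxE !eqxx !eqs /= hij hjk cos_pi3; field.
- by move=> g gij gjk; rewrite sum_col3 gij gjk hij hjk; ring.
- by move=> g gij gjk; rewrite sum_col3 gij gjk hij hjk; ring.
Qed.
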